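(* Let $\mathbb{F}_q$ be a finite field with $q$ elements. Then $\mathbb{F}_q$ is a finite definite field if and only if either $\mathbb{F}_q$ has characteristic two, or $q=p^k$ where $k$ is a positive odd integer and $p$ is a prime with $p\equiv 3\pmod 4$.
   Context: An element $x$ of a field $\mathbb{F}$ is called positive if $x=\mu^2$ for some non-zero $\mu\in\mathbb{F}$; then $\mu$ is called a square root of $x$, and if $\mu$ is itself positive, $\mu$ is called a positive square root of $x$. A field $\mathbb{F}$ is a definite field if each positive element of $\mathbb{F}$ has a positive square root in $\mathbb{F}$; a finite definite field is a definite field that is finite. *)

(* Defs.v *)
From mathcomp Require Import all_boot all_order all_algebra.

Set Implicit Arguments.
Unset Strict Implicit.
Unset Printing Implicit Defensive.

Import GRing.Theory.
Local Open Scope ring_scope.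

Definition square_root (F : fieldType) (mu x : F) : Prop :=
  mu != 0 /\ x = mu ^+ 2.

Definition positive (F : fieldType) (x : F) : Prop :=
  exists mu : F, square_root mu x.

Definition positive_square_root (F : fieldType) (mu x : F) : Prop :=
  square_root mu x /\ positive mu.

Definition definite_field (F : fieldType) : Prop :=
  forall x : F, positive x -> exists mu : F, positive_square_root mu x.

(* Main.v *)
Require Import Defs.
From mathcomp Require Import all_boot all_order all_algebra.
From mathcomp Require Import finfield.
From mathcomp Require Import zify.

Import GRing.Theory.

(** Write [q] for the number of elements of the finite field [F], so that
    [mu ^+ q = mu] for every [mu].  The proof shows that [F] is definite exactly
    when [q] is not congruent to 1 modulo 4, and then translates this condition
    into one on the characteristic and the exponent.

    The identity [mu ^+ q = mu] produces positive square roots explicitly.  When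
    [q] is even, [mu] is itself the square of [mu ^+ (q / 2)].  When
    [q = 4 m + 3], the element [nu = mu ^+ (2 (m + 1))] is visibly a square, and
    [nu ^+ 2 = mu ^+ (q + 1) = mu ^+ 2], so [nu] is a positive square root of
    [mu ^+ 2].

    In a definite field every nonzero square is a fourth power.  If
    [q = 4 m + 1], raising [x ^+ 2 = y ^+ 4] to the power [m] gives
    [x ^+ (2 m) = y ^+ (q - 1) = 1] for each of the [4 m] nonzero [x], which is
    too many roots for a polynomial of degree [2 m].

    Finally [q] is a power [p ^ k] of the characteristic: it is even exactly when
    [p = 2], and it is 3 modulo 4 exactly when [p] is 3 modulo 4 and [k] is
    odd. *)

(** In a definite field, the square [mu ^+ 2] has a root [nu] which is itself a
    square [y ^+ 2], whence [mu ^+ 2 = y ^+ 4]; conversely such a [y] makes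
    [y ^+ 2] a positive square root. *)
Lemma definite_fieldP (F : fieldType) :
  definite_field F <->
  forall mu : F, mu != 0%R -> exists y : F, (mu ^+ 2 = y ^+ 4)%R /\ y != 0%R.
Proof.
split=> [defF mu mu0 | quartic x [mu [mu0 ->]]].
  have [|nu [[_ ->] [y [y0 ->]]]] := defF (mu ^+ 2)%R; first by exists mu.
  by exists y; rewrite -exprM.
have [y [-> y0]] := quartic mu mu0.
exists (y ^+ 2)%R; split; last by exists y.
by split; rewrite ?expf_neq0 // -exprM.
Qed.

Lemma card_even_definite (F : finFieldType) :
  ~~ odd #|F| -> definite_field F.
Proof.
move=> evenF; apply/definite_fieldP => mu mu0.
exists (mu ^+ #|F|./2)%R; split; last exact: expf_neq0.
by rewrite -{1}(expf_card mu) -!exprM; congr (_ ^+ _)%R; lia.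
Qed.

Lemma card_3mod4_definite (F : finFieldType) :
  #|F| %% 4 = 3 -> definite_field F.
Proof.
move=> card3; apply/definite_fieldP => mu mu0.
exists (mu ^+ (#|F| %/ 4).+1)%R; split; last exact: expf_neq0.
rewrite expr2 -{1}(expf_card mu) -exprSr -exprM; congr (_ ^+ _)%R; lia.
Qed.

Lemma card_1mod4_not_definite (F : finFieldType) :
  #|F| %% 4 = 1 -> ~ definite_field F.
Proof.
move=> card1 /definite_fieldP quartic.
have card_gt1 : 1 < #|F| := finNzRing_gt1 F.
pose m := #|F| %/ 4.
have m2_gt0 : 0 < 2 * m by rewrite /m; lia.
have sizeP : size ('X^(2 * m) - 1%:P : {poly F})%R = (2 * m).+1.
  exact: size_XnsubC.
have P0 : ('X^(2 * m) - 1%:P : {poly F})%R != 0%R by rewrite -size_poly_eq0 sizeP.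
have : size (enum (predC1 (0%R : F))) < size ('X^(2 * m) - 1%:P : {poly F})%R.
  apply: max_poly_roots => //; last exact: enum_uniq.
  apply/allP => x; rewrite mem_enum inE => x0.
  have [y [xy y0]] := quartic x x0.
  rewrite /root !hornerE exprM xy -exprM subr_eq0; apply/eqP.
  apply: (mulIf y0); rewrite mul1r -exprSr -[RHS]expf_card.
  by congr (_ ^+ _)%R; rewrite /m; lia.
have card_nz : #|predC1 (0%R : F)| = #|F|.-1 := cardC1 _.
by rewrite -cardE card_nz sizeP /m; lia.
Qed.

Lemma definite_card (F : finFieldType) :
  definite_field F <-> (~~ odd #|F| \/ #|F| %% 4 = 3).
Proof.
split=> [defF | [/card_even_definite | /card_3mod4_definite] //].
have [card1 | card_neq1] := eqVneq (#|F| %% 4) 1; last lia.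
by case: (card_1mod4_not_definite F card1).
Qed.

(** A finite field is a vector space over its prime field. *)
Lemma finField_card_pchar (F : finFieldType) (p : nat) (charFp : p \in [pchar F]%R) :
  #|F| = p ^ logn p #|F|.
Proof. exact: (card_pprimeChar charFp). Qed.

(** An odd square is 1 modulo 4, so for odd [p] only the parity of [k] matters. *)
Lemma expn_3mod4 (p k : nat) :
  (p ^ k %% 4 == 3) = odd k && (p %% 4 == 3).
Proof.
have [oddp|evenp] := boolP (odd p); last first.
  (* A power of an even number is even, or equal to 1. *)
  case: k => [|k]; first by rewrite expn0.
  have : ~~ odd (p ^ k.+1) by rewrite oddX.
  by move: (p ^ k.+1) => n; lia.
rewrite -[in LHS](odd_double_half k) expnD -mul2n expnM.
have p2 : p ^ 2 = 1 %[mod 4].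
  rewrite -modnXm; have: p %% 4 < 4 by rewrite ltn_mod.
  have: odd (p %% 4) by lia.
  by case: (p %% 4) => [|[|[|[|]]]].
rewrite -modnMmr -modnXm p2 modnXm exp1n modnMmr muln1.
by case: (odd k); rewrite ?expn1.
Qed.

Theorem theorem1 (F : finFieldType) (q : nat) (hq : #|F| = q) :
  definite_field F <->
  (2 \in [pchar F]%R \/
   exists p k : nat,
     [/\ prime p, p = 3 %[mod 4], 0 < k, odd k & q = p ^ k]).
Proof.
subst q; rewrite definite_card.
have [p p_prime charFp] := finPcharP F.
have cardF := finField_card_pchar F p charFp.
split=> [[evenF | card3] | [char2 | [r [k [_ r3 _ oddk ->]]]]].
- left; move: evenF; rewrite cardF oddX negb_or => /andP[_ evenp].
  by have [<-|/(conj evenp)] := even_prime p_prime; last case=> /negP.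
- right; exists p, (logn p #|F|).
  have /andP[oddk /eqP p3] : odd (logn p #|F|) && (p %% 4 == 3).
    by rewrite -expn_3mod4 -cardF card3.
  by split; rewrite // odd_gt0.
- left; rewrite (finField_card_pchar F 2 char2) oddX orbF -lt0n.
  have := finNzRing_gt1 F; rewrite {1}(finField_card_pchar F 2 char2).
  by case: (logn _ _).
by right; apply/eqP; rewrite expn_3mod4 oddk r3.
Qed.
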